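(* If $G$ is a connected biconvex graph, then $\gamma(G)\le 2\rho(G)$.
   Context: All graphs are finite and simple. A bipartite graph with parts $X,Y$ is biconvex if $X$ has an ordering in which $N(y)$ is a set of consecutive vertices for every $y\in Y$, and $Y$ has an ordering in which $N(x)$ is a set of consecutive vertices for every $x\in X$. $\gamma(G)$ is the minimum size of a dominating set (a set $D$ such that every vertex outside $D$ has a neighbor in $D$). A packing is a set of vertices with pairwise disjoint closed neighborhoods (equivalently pairwise distance at least $3$); $\rho(G)$ is the maximum size of a packing. *)

(* Defs.v *)
From mathcomp Require Import all_boot.
Set Implicit Arguments.
Unset Strict Implicit.
Unset Printing Implicit Defensive.

Record sgraph := SGraph {
  svertex :> finType;
  adj : rel svertex;
  adj_sym : symmetric adj;
  adj_irrefl : irreflexive adj }.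

Section GraphDefs.
Variable G : sgraph.
Implicit Types (x y : G) (X Y D P : {set G}) (s : seq G).

Definition nbhd x : {set G} := [set y | adj x y].
Definition cl_nbhd x : {set G} := x |: nbhd x.

Definition connected_graph : Prop := forall x y, connect (@adj G) x y.

Definition bipartition X Y : Prop :=
  [/\ X :|: Y = [set: G], [disjoint X & Y] &
      forall x y, adj x y -> (x \in X) = (y \in Y)].

Definition ordering_of s X : Prop := uniq s /\ s =i X.

(* The block t may be empty, so an isolated vertex imposes no constraint. *)
Definition consecutive_in s X : Prop := exists2 t, infix t s & t =i X.

Definition convex_over X Y : Prop :=
  exists2 s, ordering_of s X & forall y, y \in Y -> consecutive_in s (nbhd y).

Definition biconvex : Prop :=
  exists X Y, [/\ bipartition X Y, convex_over X Y & convex_over Y X].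

Definition dominating D : bool :=
  [forall (x | x \notin D), exists y in D, adj x y].

Definition packing P : bool :=
  [forall x in P, forall y in P, (x != y) ==> [disjoint cl_nbhd x & cl_nbhd y]].

(* The arg min is meaningful because [set: G] is dominating; see gamma_min. *)
Definition gamma : nat := #|[arg min_(D < [set: G] | dominating D) #|D|]|.

Definition rho : nat := \max_(P | packing P) #|P|.

Lemma dominating_setT : dominating [set: G].
Proof. by apply/forall_inP => x; rewrite inE. Qed.

Lemma gamma_min :
  (exists2 D, dominating D & #|D| = gamma) /\
  (forall D, dominating D -> gamma <= #|D|).
Proof.
rewrite /gamma; case: arg_minnP => [|D domD minD]; first exact: dominating_setT.
by split=> //; exists D.
Qed.

Lemma rho_max :
  (exists2 P, packing P & #|P| = rho) /\ (forall P, packing P -> #|P| <= rho).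
Proof.
have pack0 : packing set0 by apply/forall_inP => x; rewrite inE.
split=> [|P packP]; last exact: leq_bigmax_cond.
have [|P packP maxP] := @eq_bigmax_cond _ packing (fun P => #|P|).
  by apply/card_gt0P; exists set0.
by exists P; rewrite -?maxP.
Qed.

End GraphDefs.

(* Main.v *)
Require Import Defs.
From mathcomp Require Import all_boot.

Set Implicit Arguments.
Unset Strict Implicit.
Unset Printing Implicit Defensive.

(** Each part of the bipartition is dominated by a set that is no larger than
    some packing inside that part; the union of the two dominating sets then has
    size at most twice the packing number.  For one part, proceed greedily along
    its convex ordering: put the first undominated vertex [x] into the packing and
    dominate it by a neighbour covering as many undominated vertices as possible.
    By convexity no neighbour of [x] reaches a vertex that is still undominated
    after this step, so the vertices picked have pairwise no common neighbour. *)

(** Write [s] as [p ++ t ++ q]. An entry of [p] has index below [size p], hence precedes [x]; an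
    entry outside [p] and [t] has index at least [size p + size t], hence follows [z]. *)
Lemma infix_index_convex (T : eqType) (s t : seq T) (x u z : T) :
  uniq s -> infix t s -> x \in t -> z \in t -> u \in s ->
  index x s <= index u s <= index z s -> u \in t.
Proof.
move=> us /infixP[p [q def_s]] xt zt; move: us; rewrite def_s !cat_uniq.
case/and3P=> _ /hasPn dis_p /and3P[_ _ _].
have notp v : v \in t -> v \in p = false.
  by move=> vt; apply/negbTE/dis_p; rewrite mem_cat vt.
rewrite !mem_cat !index_cat (notp x xt) (notp z zt) xt zt => _ /andP[le_xu le_uz].
have [//|ut] := boolP (u \in t).
have [up|up] := boolP (u \in p).
  move: le_xu; rewrite up leqNgt.
  by rewrite (leq_trans _ (leq_addr _ _)) // index_mem.
move: le_uz; rewrite (negbTE up) (negbTE ut) leq_add2l leqNgt.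
by rewrite (leq_trans _ (leq_addr _ _)) // index_mem.
Qed.

Section OnePart.
Variable G : sgraph.
Implicit Types (x y z : G) (X Y U D P : {set G}).

Definition dominates D x : bool := (x \in D) || [exists y in D, adj x y].

Definition unlinked P : Prop :=
  {in P &, forall x z, x != z -> [disjoint nbhd x & nbhd z]}.

Lemma dominatesS D D' x : D \subset D' -> dominates D x -> dominates D' x.
Proof.
move=> /subsetP sDD' /orP[/sDD' xD'|/exists_inP[y /sDD' yD' xy]].
  by rewrite /dominates xD'.
by apply/orP; right; apply/exists_inP; exists y.
Qed.

Lemma bipartition_sym X Y : bipartition X Y -> bipartition Y X.
Proof.
case=> XY disXY adjXY; split; rewrite 1?setUC 1?disjoint_sym // => x y xy.
by rewrite -(adjXY y x) // adj_sym.
Qed.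

(** Since [X] is independent, the closed neighbourhoods of two of its vertices can only meet in a
    common neighbour, so disjoint open neighbourhoods suffice. *)
Lemma unlinked_packing X Y P :
  bipartition X Y -> P \subset X -> unlinked P -> packing P.
Proof.
case=> _ disXY adjXY /subsetP sPX unlP.
have nadj x z : x \in P -> z \in P -> adj x z = false.
  move=> /sPX xX /sPX zX; apply/negP => /adjXY; rewrite xX => /esym.
  by rewrite (disjointFr disXY zX).
apply/forall_inP => x xP; apply/forall_inP => z zP; apply/implyP => xz.
rewrite disjoints_subset; apply/subsetP => w; rewrite !inE.
case/predU1P=> [->|xw]; first by rewrite negb_or xz nadj.
rewrite negb_or; apply/andP; split.
  by apply: contraTneq xw => ->; rewrite nadj.
by have := disjointFr (unlP _ _ xP zP xz); move/(_ w); rewrite !inE xw => ->.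
Qed.

Lemma greedy_dominates X Y U :
  bipartition X Y -> convex_over X Y -> U \subset X ->
  exists D P, [/\ #|D| <= #|P|, P \subset U, unlinked P &
                  {in U, forall x, dominates D x}].
Proof.
move=> [_ disXY adjXY] [s [us memsX] convY].
have [n] := ubnP #|U|; elim: n U => // n IHn U leUn /subsetP sUX.
have [->|[x0 x0U]] := set_0Vmem U.
  by exists set0, set0; split; rewrite ?cards0 // => x; rewrite inE.
have [x xU minx] : exists2 x, x \in U & {in U, forall v, index x s <= index v s}.
  by have [x xU minx] := arg_minnP (fun v => index v s) x0U; exists x.
(* One greedy round: [d] joins the dominating set, [x] joins the packing, and induction continues on
   [U :\: W]. *)
suff [d [W [xW sUW sep]]] : exists d (W : {set G}), [/\ x \in W,
    {in U :&: W, forall v, dominates [set d] v} &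
    {in U :\: W, forall p, [disjoint nbhd x & nbhd p]}].
  have [||D [P [leDP sPU unlP domD]]] := IHn (U :\: W).
  - rewrite -ltnS (leq_trans _ leUn) // ltnS proper_card //.
    apply/properP; split; first exact: subsetDl.
    by exists x; rewrite // inE xW.
  - by apply: subset_trans (subsetDl _ _) _; apply/subsetP.
  exists (d |: D), (x |: P); split.
  - rewrite !cardsU1; have -> : x \notin P.
      by apply: contraTN xW => /(subsetP sPU); rewrite inE => /andP[].
    by rewrite leq_add // leq_b1.
  - by rewrite subUset sub1set xU (subset_trans sPU) // subsetDl.
  - move=> p q /setU1P[->|pP] /setU1P[->|qP] pq.
    + by rewrite eqxx in pq.
    + exact/sep/(subsetP sPU).
    + by rewrite disjoint_sym; apply/sep/(subsetP sPU).
    + exact: unlP.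
  - move=> v vU; have [vW|vW] := boolP (v \in W).
      by apply: dominatesS (sUW v _); rewrite ?subsetUl // inE vU.
    by apply: dominatesS (domD v _); rewrite ?subsetUr // inE vW.
(* An isolated [x] can only be dominated by itself and has no neighbour to share. *)
have [nx0|[y0 xy0]] := set_0Vmem (nbhd x).
  exists x, [set x]; split; first by rewrite inE.
    by move=> v /setIP[_ vx]; rewrite /dominates vx.
  by move=> p _; rewrite nx0 -setI_eq0 set0I.
have [y xy maxy] : exists2 y, y \in nbhd x &
    {in nbhd x, forall z, #|nbhd z :&: U| <= #|nbhd y :&: U|}.
  by have [y xy maxy] := arg_maxnP (fun y => #|nbhd y :&: U|) xy0; exists y.
have nbC v w : (v \in nbhd w) = (w \in nbhd v) by rewrite !inE adj_sym.
exists y, (nbhd y); split; first by rewrite nbC.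
  move=> v /setIP[_ yv]; apply/orP; right; apply/exists_inP.
  by exists y; rewrite ?inE //; move: yv; rewrite inE adj_sym.
move=> p /setDP[pU pNy]; rewrite disjoints_subset; apply/subsetP => z xz.
(* A common neighbour [z] of [x] and [p] would contradict the choice of [y]: its trace on [U]
   contains that of [y], and also [p]. *)
rewrite inE; apply/negP => pz; have := maxy z xz; rewrite leqNgt => /negP; apply.
have NY w : w \in nbhd x -> w \in Y.
  by rewrite inE => /adjXY <-; apply: sUX.
have convN w a b c : w \in nbhd x -> a \in nbhd w -> c \in nbhd w -> b \in U ->
    index a s <= index b s <= index c s -> b \in nbhd w.
  move=> /NY /convY[t tis memt]; rewrite -!memt => at_ ct bU.
  by apply: infix_index_convex ct _ => //; rewrite memsX sUX.
apply: proper_card; apply/properP; split; last first.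
  by exists p; rewrite inE ?(negbTE pNy) // nbC pz.
apply/subsetP => v /setIP[yv vU]; rewrite inE vU andbT.
(* If [p] came before [v], it would lie between [x] and [v] and so be adjacent to [y]. Hence [v]
   lies between [x] and [p], both neighbours of [z]. *)
have le_vp : index v s <= index p s.
  rewrite leqNgt; apply: contra pNy => /ltnW le_pv.
  by apply: (convN y x p v); rewrite // ?le_pv ?minx // nbC.
by apply: (convN z x v p); rewrite // ?le_vp ?minx // nbC.
Qed.

Lemma convex_part_dominates X Y :
  bipartition X Y -> convex_over X Y ->
  exists2 D : {set G}, #|D| <= rho G & {in X, forall x, dominates D x}.
Proof.
move=> bip cvx.
have [D [P [leDP sPX unlP domD]]] := greedy_dominates bip cvx (subxx X).
exists D => //; apply: leq_trans leDP _.
exact: (rho_max G).2 (unlinked_packing bip sPX unlP).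
Qed.

End OnePart.

Theorem theorem15 (G : sgraph) (hconn : connected_graph G) (hbic : biconvex G) :
  gamma G <= 2 * rho G.
Proof.
have [X [Y [bip cvX cvY]]] := hbic.
have [D leD domD] := convex_part_dominates bip cvX.
have [E leE domE] := convex_part_dominates (bipartition_sym bip) cvY.
have domDE : dominating (D :|: E).
  apply/forall_inP => x xDE.
  suff : dominates (D :|: E) x by rewrite /dominates (negbTE xDE).
  have [XY _ _] := bip; have : x \in X :|: Y by rewrite XY inE.
  case/setUP=> [/domD|/domE]; apply: dominatesS; [exact: subsetUl|exact: subsetUr].
apply: leq_trans ((gamma_min G).2 _ domDE) _.
by rewrite mul2n -addnn (leq_trans (leq_card_setU _ _)) // leq_add.
Qed.
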